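(* Let $\mathbb{L}$ be an $F$-finite field of characteristic $p>0$, let $\mathscr{M}=\{\boldsymbol{x}^{\boldsymbol{a}_1},\dots,\boldsymbol{x}^{\boldsymbol{a}_n}\}$ be a collection of $n$ distinct monomials in $x_1,\dots,x_m$ with all $\boldsymbol{a}_i\in\mathbb{N}^m$ non-zero, and let $f=\sum_{i=1}^n u_i\boldsymbol{x}^{\boldsymbol{a}_i}$ be a polynomial over $\mathbb{L}$ with $\operatorname{Supp}(f)=\mathscr{M}$. If $\operatorname{fpt}_{\mathfrak{m}}(\mathscr{M})\le 1$ and $(p-1)\cdot\boldsymbol{\eta}\in\mathbb{N}^n$ for some maximal point $\boldsymbol{\eta}$ of the splitting polytope $\boldsymbol{P}$ of $\mathscr{M}$, then there exists a non-empty closed set $Z\subseteq\mathbb{A}^n_{\mathbb{L}}$ such that $\operatorname{fpt}_{\mathfrak{m}}(f)=\operatorname{fpt}_{\mathfrak{m}}(\mathscr{M})$ whenever $(u_1,\dots,u_n)$, the coefficients of $f$, are not in $Z$.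
   Context: A field $\mathbb{L}$ of characteristic $p>0$ is $F$-finite if $[\mathbb{L}:\mathbb{L}^p]<\infty$. $\operatorname{Supp}(f)$ is the set of monomials occurring in $f$ with non-zero coefficient. $\mathbb{N}$ contains $0$. $F$-pure thresholds: in $\mathbb{L}[x_1,\dots,x_m]$ let $\mathfrak{m}=(x_1,\dots,x_m)$ and $\mathfrak{m}^{[p^e]}=(x_1^{p^e},\dots,x_m^{p^e})$. For a non-zero ideal $\mathfrak{a}\subseteq\mathfrak{m}$ let $\nu_{\mathfrak{a}}(p^e)=\max\{r:\mathfrak{a}^r\not\subseteq\mathfrak{m}^{[p^e]}\}$ and $\operatorname{fpt}_{\mathfrak{m}}(\mathfrak{a})=\lim_{e\to\infty}\nu_{\mathfrak{a}}(p^e)/p^e$ (the limit exists). $\operatorname{fpt}_{\mathfrak{m}}(f)$ is that of the ideal $(f)$; $\operatorname{fpt}_{\mathfrak{m}}(\mathscr{M})$ is that of the ideal generated by $\mathscr{M}$. Splitting polytope: $\mathbf{E}$ is the $m\times n$ matrix with columns $\boldsymbol{a}_1,\dots,\boldsymbol{a}_n$, and $\boldsymbol{P}=\{\boldsymbol{s}\in\mathbb{R}^n_{\ge0}:\text{every entry of }\mathbf{E}\boldsymbol{s}\text{ is}\le1\}$. A maximal point is a point of $\boldsymbol{P}$ at which $|\boldsymbol{s}|=s_1+\cdots+s_n$ attains its maximum on $\boldsymbol{P}$. $\mathbb{A}^n_{\mathbb{L}}$ is affine $n$-space over $\mathbb{L}$, and closed means Zariski closed. *)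

(* Defs.v *)
From mathcomp Require Import all_boot all_order all_algebra.
From mathcomp Require Import boolp classical_sets reals topology normedtype sequences.
From mathcomp Require mpoly.
(* The notations of mpoly cannot be parsed together with those of
   MathComp-Analysis, so only its canonical structures, coercions and names are
   imported: {mpoly L[m]}, 'X_{1..m}, 'X_[a], 'X_i and g.@[u] are written
   mpoly m L, multinom m, mpolyX L a, mpolyX L (mnm1 i) and meval u g. *)
Export -(notations) mpoly.

Set Implicit Arguments.
Unset Strict Implicit.
Unset Printing Implicit Defensive.

Import Order.TTheory GRing.Theory Num.Theory.
Import numFieldNormedType.Exports.
Local Open Scope ring_scope.
Local Open Scope classical_set_scope.

(* [L : L^p] < oo: finitely many elements span L as a vector space over its
   subfield of p-th powers. *)
Definition F_finite (p : nat) (L : fieldType) : Prop :=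
  exists (d : nat) (b : 'I_d -> L),
    forall x : L, exists c : 'I_d -> L, x = \sum_(i < d) c i ^+ p * b i.

Section Ideals.
Variable A : comNzRingType.

Definition ideal_gen (S : set A) : set A :=
  [set g | exists (k : nat) (c h : 'I_k -> A),
     (forall i, S (h i)) /\ g = \sum_(i < k) c i * h i].

(* For r = 0 the only generator is the empty product, so I^0 is the unit
   ideal. *)
Definition ideal_pow (I : set A) (r : nat) : set A :=
  ideal_gen [set g | exists h : 'I_r -> A,
     (forall i, I (h i)) /\ g = \prod_(i < r) h i].

End Ideals.

(* The maximum of N, and 0 if N has no maximum. *)
Definition nat_max (N : set nat) : nat :=
  xget 0%N [set r | N r /\ forall s, N s -> (s <= r)%N].

Section FPureThreshold.
Variables (L : fieldType) (m : nat).

(* The ideal (x_1^q, ..., x_m^q); for q a power of the characteristic it is the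
   Frobenius power of the maximal ideal at the origin. *)
Definition frob_max_ideal (q : nat) : set (mpoly m L) :=
  ideal_gen [set mpolyX L (mnm1 i) ^+ q | i in [set: 'I_m]].

Definition nu (I : set (mpoly m L)) (q : nat) : nat :=
  nat_max [set r | ~ (ideal_pow I r `<=` frob_max_ideal q)].

(* Meaningful for a non-zero ideal I contained in (x_1, ..., x_m): then every
   maximum and the limit exist. *)
Definition fpt (R : realType) (p : nat) (I : set (mpoly m L)) : R :=
  lim (((nu I (p ^ e)%N)%:R / (p ^ e)%:R : R) @[e --> \oo]).

Definition fpt_poly (R : realType) (p : nat) (f : mpoly m L) : R :=
  fpt R p (ideal_gen [set f]).

Definition fpt_monomials (R : realType) (p : nat) (n : nat)
    (a : 'I_n -> multinom m) : R :=
  fpt R p (ideal_gen (range (fun i => mpolyX L (a i)))).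

End FPureThreshold.

Section SplittingPolytope.
Variables (R : realType) (m n : nat) (a : 'I_n -> multinom m).

Definition exponent_matrix : 'M[R]_(m, n) := \matrix_(i, j) (a j i)%:R.

Definition splitting_polytope : set 'cV[R]_n :=
  [set s : 'cV[R]_n |
     (forall j, 0 <= s j 0) /\ (forall i, (exponent_matrix *m s) i 0 <= 1)].

Definition coord_sum (s : 'cV[R]_n) : R := \sum_j s j 0.

Definition maximal_point (s : 'cV[R]_n) : Prop :=
  splitting_polytope s /\
  forall t, splitting_polytope t -> coord_sum t <= coord_sum s.

End SplittingPolytope.

(* Affine n-space is taken as the set L^n of its L-points. *)
Definition zariski_closed (L : fieldType) (n : nat) (Z : set ('I_n -> L)) : Prop :=
  exists S : set (mpoly n L), Z = [set u | forall g, S g -> meval u g = 0].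

(* Main.v *)
Require Import Defs.
From mathcomp Require Import all_boot all_order all_algebra.
From mathcomp Require Import boolp classical_sets reals topology normedtype sequences.

(* For every maximal point eta, fpt(M) = |eta|: a product of r monomials of M
   lying outside m^[q] yields a point of the polytope of coordinate sum r / q,
   and x^(E (p^e - 1) eta) attains the bound up to |eta| / p^e.  The same upper
   bound holds for f.  For the lower bound put k = (p - 1) eta and N = |k|, so
   N < p because |eta| <= 1.  The coefficient of x^(E k) in f^N is Theta(u),
   where Theta contains the monomial u^k with coefficient N! / (k_1! ... k_n!),
   non-zero modulo p.  If Theta(u) <> 0 then f^N is outside m^[p], and
   f^(N (1 + p + ... + p^(e-1))) is outside m^[p^e] for all e, which gives
   fpt(f) >= |eta|.  Take Z = {Theta = 0}: it contains 0 as Theta is homogeneous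
   of degree N > 0, and it is not all of L^n, even for finite L, because every
   exponent occurring in Theta is less than p. *)

Set Implicit Arguments.
Unset Strict Implicit.
Unset Printing Implicit Defensive.

Import Order.TTheory GRing.Theory Num.Theory.
Import numFieldNormedType.Exports.
Local Open Scope ring_scope.
Local Open Scope classical_set_scope.

(** * Membership in generated ideals and in their powers *)

Section IdealGeneration.
Variables (A : comNzRingType) (S : set A).

Lemma ideal_gen_mem g : S g -> ideal_gen S g.
Proof.
move=> Sg; exists 1%N, (fun=> 1), (fun=> g); split=> //.
by rewrite big_ord1 mul1r.
Qed.

Lemma ideal_gen0 : ideal_gen S 0.
Proof.
exists 0%N, (fun=> 0), (fun=> 0); split=> [[] //|].
by rewrite big_ord0.
Qed.

Lemma ideal_genD g h : ideal_gen S g -> ideal_gen S h -> ideal_gen S (g + h).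
Proof.
move=> [k [c [s [Ss ->]]]] [l [d [t [St ->]]]].
pose cat (u : 'I_k -> A) (v : 'I_l -> A) i :=
  match split i with inl j => u j | inr j => v j end.
exists (k + l)%N, (cat c d), (cat s t); split=> [i|].
  by rewrite /cat; case: split.
rewrite big_split_ord /=; congr (_ + _); apply: eq_bigr => i _.
  by rewrite /cat -[lshift l i]/(unsplit (inl i)) unsplitK.
by rewrite /cat -[rshift k i]/(unsplit (inr i)) unsplitK.
Qed.

Lemma ideal_gen_sum (I : Type) (r : seq I) (P : pred I) (F : I -> A) :
  (forall i, P i -> ideal_gen S (F i)) ->
  ideal_gen S (\sum_(i <- r | P i) F i).
Proof.
by move=> SF; apply: big_ind SF; [exact: ideal_gen0 | exact: ideal_genD].
Qed.

Lemma ideal_gen_mulr c g : S g -> ideal_gen S (c * g).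
Proof.
move=> Sg; exists 1%N, (fun=> c), (fun=> g); split=> //.
by rewrite big_ord1.
Qed.

Lemma ideal_pow_prod r (h : 'I_r -> A) :
  (forall i, S (h i)) -> ideal_pow S r (\prod_(i < r) h i).
Proof.
move=> Sh; exists 1%N, (fun=> 1), (fun=> \prod_i h i).
by rewrite big_ord1 mul1r; split=> // _; exists h.
Qed.

Lemma ideal_pow_exp r h : S h -> ideal_pow S r (h ^+ r).
Proof.
by move=> Sh; rewrite -[r in X in ideal_pow S r X]card_ord -prodr_const;
  apply: ideal_pow_prod.
Qed.

End IdealGeneration.

(** * Frobenius powers of the maximal ideal, read off the support *)

Section MonomialSupport.
Variables (L : fieldType) (m : nat).
Implicit Types (g h : mpoly m L) (b : multinom m) (q : nat).

Definition has_small_monomial q g :=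
  has (fun b => [forall i, b i < q])%N (msupp g).

Lemma mpoly_mulXE b c g :
  mcoeff b (g * mpolyX L c) = if mpoly.lem c b then mcoeff (mnm_sub b c) g else 0.
Proof.
case: ifPn => [cb | ncb].
  by rewrite -{1}(submK cb) addmC mcoeffMX.
apply/eqP; rewrite mcoeff_eq0 (perm_mem (msuppMX _ _)).
apply: contra ncb => /mapP [d _ ->]; exact: lem_addr.
Qed.

(** The ideal is generated by monomials, so it contains a polynomial as soon as each monomial of it
    is divisible by some [x_i^q], and only then. *)
Lemma frob_max_idealP q g : frob_max_ideal q g <-> ~~ has_small_monomial q g.
Proof.
split=> [[k [c [h [hq ->]]]] | /hasPn gbig].
  apply/hasPn => b; rewrite mcoeff_msupp; apply: contraNN => /forallP bq.
  rewrite raddf_sum big1 //= => i _; have [j _ <-] := hq i.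
  rewrite mpolyXn mpoly_mulXE ifF //; apply/negbTE/negP => /mnm_lepP /(_ j).
  by rewrite mulmnE mnm1E eqxx mul1n leqNgt bq.
rewrite [g]mpolyE big_seq; apply: ideal_gen_sum => b /gbig.
rewrite negb_forall => /existsP [i]; rewrite -leqNgt => qbi.
have le_b : mpoly.lem (mnm_muln (mnm1 i) q) b.
  apply/mnm_lepP => j; rewrite mulmnE mnm1E.
  by case: eqP => [<-|]; rewrite ?mul1n ?mul0n.
rewrite -(submK le_b) mpolyXD -mpolyXn.
by rewrite scalerAl; apply: ideal_gen_mulr; exists i.
Qed.

End MonomialSupport.

(** * From [p] to [p^e] by the Frobenius map *)

Section Frobenius.
Variables (L : fieldType) (p : nat) (hp : p \in [pchar L]) (m : nat).
Implicit Types (g h : mpoly m L) (b c : multinom m) (q : nat).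

Lemma mpoly_frobenius g :
  g ^+ p = \sum_(b <- msupp g) mcoeff b g ^+ p *: mpolyX L (mnm_muln b p).
Proof.
have hpm : p \in [pchar mpoly m L] by rewrite pchar_lalg.
rewrite -(pFrobenius_autE hpm) {1}[g]mpolyE rmorph_sum; apply: eq_bigr => b _.
by rewrite /= pFrobenius_autE exprZn mpolyXn.
Qed.

(* If [b] is a monomial of [g] of minimal degree among the small ones, then the
   coefficient of [x^(r + p b)] in [h * g ^+ p] is the product of that of [x^r]
   in [h] and of the [p]-th power of that of [x^b] in [g]: as [r < p], another
   monomial [x^c] of [g] contributes only if [c] is dominated by [b]. *)
Lemma has_small_monomial_mul_frob q h g :
  has_small_monomial p h -> has_small_monomial q g ->
  has_small_monomial (p * q) (h * g ^+ p).
Proof.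
have p_gt0 : (0 < p)%N := prime_gt0 (pcharf_prime hp).
move=> /hasP [r rh /forallP rp] /hasP [b0 b0g /forallP b0q].
pose Q d := has (fun b => (mdeg b == d) && [forall i, b i < q]%N) (msupp g).
have exQ : exists d, Q d.
  by exists (mdeg b0); apply/hasP; exists b0; rewrite ?eqxx //; apply/forallP.
case: (ex_minnP exQ) => d /hasP [b bg /andP [/eqP db /forallP bq]] dmin.
apply/hasP; exists (mnm_add r (mnm_muln b p)); last first.
  apply/forallP => i; rewrite mnmDE mulmnE.
  apply: (@leq_trans (p + b i * p)); first by rewrite ltn_add2r.
  by rewrite -mulSn mulnC leq_mul2l bq orbT.
rewrite mcoeff_msupp mpoly_frobenius mulr_sumr raddf_sum /=.
rewrite (bigD1_seq b) //= big_seq_cond big1 => [|c /andP [cg cb]]; last first.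
  rewrite -scalerAr mcoeffZ mpoly_mulXE ifF ?mulr0 //.
  apply: contraNF cb => /mnm_lepP le_c.
  have {}le_c i : (c i <= b i)%N.
    rewrite -ltnS -(ltn_pmul2r p_gt0) mulSn.
    by apply: leq_ltn_trans (_ : (r i + b i * p < _)%N); rewrite ?ltn_add2r //;
       have := le_c i; rewrite mnmDE !mulmnE.
  have : (d <= mdeg c)%N.
    apply: dmin; apply/hasP; exists c; rewrite // eqxx /=.
    by apply/forallP => i; apply: leq_ltn_trans (bq i).
  rewrite -db !mdegE => le_bc; apply/eqP/mnmP => i; apply/eqP.
  have le_sum : (\sum_i c i <= \sum_i b i ?= iff [forall i, c i == b i])%N.
    by apply: leqif_sum => j _; split; rewrite ?le_c.
  by have := geq_leqif le_sum; rewrite le_bc => /esym /forallP /(_ i).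
rewrite addr0 -scalerAr mcoeffZ addmC mcoeffMX mulf_neq0 //.
  by rewrite expf_neq0 // -mcoeff_msupp.
by rewrite -mcoeff_msupp.
Qed.

(** Induction on [e]: since [1 + p + ... + p^e = 1 + p (1 + ... + p^(e-1))], the next power is [g^N]
    times the [p]-th power of the previous one. *)
Lemma has_small_monomial_exp g N e :
  has_small_monomial p (g ^+ N) ->
  has_small_monomial (p ^ e)%N (g ^+ (N * \sum_(i < e) p ^ i)).
Proof.
move=> gN; elim: e => [|e IHe].
  rewrite big_ord0 muln0 expr0 expn0; apply/hasP; exists (mnm0 : multinom m).
    by rewrite msupp1 inE.
  by apply/forallP => i; rewrite mnm0E.
rewrite big_ord_recl expn0 mulnDr muln1 exprD expnS.
rewrite (eq_bigr (fun i : 'I_e => p * p ^ i)%N) => [|i _]; last first.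
  by rewrite lift0 expnS.
rewrite -big_distrr /= mulnCA [X in _ * _ ^+ X]mulnC exprM.
exact: has_small_monomial_mul_frob.
Qed.

End Frobenius.

(** * Computing a threshold by squeezing *)

Section FptBounds.
Variables (R : realType) (L : fieldType) (p : nat) (p_gt1 : (1 < p)%N) (m : nat).

Lemma nat_max_le (N : set nat) (B : R) :
  0 <= B -> (forall r, N r -> r%:R <= B) -> (nat_max N)%:R <= B.
Proof. by move=> B0 NB; rewrite /nat_max; case: xgetP => // r _ [/NB]. Qed.

(** The bound [B] ensures that the maximum exists, so that [nat_max] does not take its default value
    0. *)
Lemma nat_max_ge (N : set nat) (B : R) r :
  (forall s, N s -> s%:R <= B) -> N r -> (r <= nat_max N)%N.
Proof.
move=> NB Nr.
have exN : exists r, `[< N r >] by exists r; apply/asboolP.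
have bN s : `[< N s >] -> (s <= Num.truncn B)%N.
  by move=> /asboolP /NB sB; rewrite truncn_ge_nat // (le_trans _ sB) ?ler0n.
case: (ex_maxnP exN bN) => s /asboolP Ns smax.
rewrite /nat_max; case: xgetP => [t _ [_] | /(_ s) []]; first exact.
by split=> // t Nt; apply/smax/asboolP.
Qed.

Lemma fpt_eq (I : set (mpoly m L)) (A : R) :
  0 <= A ->
  (forall r q g, (0 < q)%N -> ideal_pow I r g -> has_small_monomial q g ->
     r%:R <= A * q%:R) ->
  (forall e, exists r g, [/\ r%:R = A * ((p ^ e)%:R - 1), ideal_pow I r g &
     has_small_monomial (p ^ e)%N g]) ->
  fpt R p I = A.
Proof.
move=> A0 ub lb.
have q_gt0 e : (0 < p ^ e)%N by rewrite expn_gt0 ltnW.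
have q_gt0R e : 0 < (p ^ e)%:R :> R by rewrite ltr0n.
have nub e r : ~ (ideal_pow I r `<=` frob_max_ideal (p ^ e)) ->
    r%:R <= A * (p ^ e)%:R.
  move=> /existsNP [g /not_implyP [Ig]] ng; apply: ub Ig _ => //.
  by apply: contra_notT ng => /frob_max_idealP.
apply: cvg_lim => //.
(* For [q = p^e] the hypotheses give [A (q - 1) <= nu I q <= A q]; divide by [q]. *)
apply: (@squeeze_cvgr _ _ _ _ (fun e => A - A * p%:R^-1 ^+ e) (fun=> A)); last 2 first.
- rewrite -[X in _ --> X]subr0; apply: cvgB; first exact: cvg_cst.
  apply: cvg_geometric; rewrite ger0_norm ?invr_ge0 ?ler0n // invf_lt1 ?ltr1n //.
  by rewrite ltr0n ltnW.
- exact: cvg_cst.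
near=> e; apply/andP; split; last first.
  rewrite ler_pdivrMr //; apply: nat_max_le (nub e).
  by rewrite mulr_ge0.
have [r [g [rE Ig gs]]] := lb e.
rewrite ler_pdivlMr // mulrBl -mulrA exprVn -natrX mulVf ?gt_eqF // mulr1.
rewrite -[X in _ - X]mulr1 -mulrBr -rE ler_nat.
apply: nat_max_ge (nub e) _ => /(_ g Ig) /frob_max_idealP.
by rewrite gs.
Unshelve. all: by end_near.
Qed.

End FptBounds.

(** * Products of the given monomials and the upper bound from the polytope *)

Section ExponentSums.
Variables (R : realType) (L : fieldType) (m n : nat) (a : 'I_n -> multinom m).
Implicit Types (k : multinom n) (g h : mpoly m L) (b : multinom m).

Definition exponent_sum k : multinom m :=
  \big[@mnm_add m/mnm0]_(j < n) mnm_muln (a j) (k j).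

Lemma exponent_sumE k i : exponent_sum k i = (\sum_j a j i * k j)%N.
Proof. by rewrite mnm_sumE; apply: eq_bigr => j _; rewrite mulmnE. Qed.

Lemma exponent_sum1 j : exponent_sum (mnm1 j) = a j.
Proof.
apply/mnmP => i; rewrite exponent_sumE (bigD1 j) //= mnm1E eqxx muln1.
by rewrite big1 ?addn0 // => l lj; rewrite mnm1E eq_sym (negbTE lj) muln0.
Qed.

Lemma exponent_sumD k l :
  exponent_sum (mnm_add k l) = mnm_add (exponent_sum k) (exponent_sum l).
Proof.
apply/mnmP => i; rewrite mnmDE !exponent_sumE -big_split.
by apply: eq_bigr => j _; rewrite mnmDE mulnDr.
Qed.

Lemma mpolyX_exponent_sum k :
  mpolyX L (exponent_sum k) = \prod_j mpolyX L (a j) ^+ k j.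
Proof. by rewrite mprodXnE. Qed.

(** Membership in the [r]-th power of the monomial ideal of M, stated on supports. It serves both
    ideals of the theorem, since [f] lies in the ideal of M. *)
Definition dominates_sum r g :=
  forall b, b \in msupp g ->
    exists2 k, mdeg k = r & mpoly.lem (exponent_sum k) b.

Lemma dominates_sum0 g : dominates_sum 0 g.
Proof.
move=> b _; exists mnm0; rewrite ?mdeg0 //; apply/mnm_lepP => i.
by rewrite exponent_sumE big1 // => j _; rewrite mnm0E muln0.
Qed.

Lemma dominates_sumM r s g h :
  dominates_sum r g -> dominates_sum s h -> dominates_sum (r + s) (g * h).
Proof.
move=> gr hs b /msuppM_le /allpairsP [[c d] /= [/gr [k kr kc] /hs [l ls ld] ->]].
exists (mnm_add k l); first by rewrite mdegD kr ls.
apply/mnm_lepP => i; rewrite exponent_sumD !mnmDE.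
by rewrite leq_add ?(mnm_lepP kc) ?(mnm_lepP ld).
Qed.

Lemma dominates_sum_sum r (l : nat) (F : 'I_l -> mpoly m L) :
  (forall i, dominates_sum r (F i)) -> dominates_sum r (\sum_i F i).
Proof.
move=> Fr; apply: (big_ind (dominates_sum r)) => [b|g h gr hr b|//].
  by rewrite msupp0.
by move=> /msuppD_le; rewrite mem_cat => /orP [/gr|/hr].
Qed.

Lemma dominates_sum_ideal_gen r (S : set (mpoly m L)) g :
  (forall h, S h -> dominates_sum r h) -> ideal_gen S g -> dominates_sum r g.
Proof.
move=> Sr [l [c [h [Sh ->]]]]; apply: dominates_sum_sum => i.
by rewrite -[r]add0n; apply: dominates_sumM; [exact: dominates_sum0 | exact: Sr].
Qed.

Lemma dominates_sum_ideal_pow r (S : set (mpoly m L)) g :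
  (forall h, S h -> dominates_sum 1 h) ->
  ideal_pow (ideal_gen S) r g -> dominates_sum r g.
Proof.
move=> S1; apply: dominates_sum_ideal_gen => _ [h [Sh ->]].
elim: r h Sh => [|r IHr] h Sh; first by rewrite big_ord0; apply: dominates_sum0.
rewrite big_ord_recl; apply: (@dominates_sumM 1 r); last exact: IHr.
exact: dominates_sum_ideal_gen (Sh _).
Qed.

Lemma dominates_sum_le_maximal (eta : 'cV[R]_n) r q g :
  maximal_point a eta -> (0 < q)%N -> dominates_sum r g ->
  has_small_monomial q g -> r%:R <= coord_sum eta * q%:R.
Proof.
move=> [_ eta_max] q_gt0 gr /hasP [b /gr [k kr /mnm_lepP kb] /forallP bq].
have q_gt0R : 0 < q%:R :> R by rewrite ltr0n.
(* Entrywise [E k <= b < q], so [k / q] is a point of the polytope, of coordinate sum [r / q]. *)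
rewrite -ler_pdivrMr //; pose t : 'cV[R]_n := \col_j ((k j)%:R / q%:R).
have <- : coord_sum t = r%:R / q%:R.
  rewrite /coord_sum -kr mdegE natr_sum mulr_suml.
  by apply: eq_bigr => j _; rewrite mxE.
apply: eta_max; split=> [j|i]; first by rewrite mxE divr_ge0.
rewrite mxE; under eq_bigr do rewrite !mxE mulrA -natrM.
rewrite -mulr_suml -natr_sum -exponent_sumE ler_pdivrMr // mul1r ler_nat.
exact: leq_trans (kb i) (ltnW (bq i)).
Qed.

Lemma ideal_pow_exponent_sum (S : set (mpoly m L)) k :
  (forall j, S (mpolyX L (a j))) ->
  ideal_pow S (mdeg k) (mpolyX L (exponent_sum k)).
Proof.
move=> Sa; rewrite -(size_m2s k).
(* The list [m2s k] repeats each index [j] exactly [k j] times; it turns the product of powers into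
   a product of [mdeg k] generators. *)
suff -> : mpolyX L (exponent_sum k) =
    \prod_(i < size (m2s k)) mpolyX L (a (tnth (in_tuple (m2s k)) i)).
  exact: ideal_pow_prod.
rewrite mpolyX_exponent_sum -(big_tnth _ _ _ xpredT (fun j => mpolyX L (a j))).
rewrite big_flatten big_map big_enum; apply: eq_bigr => j _ /=.
by rewrite big_nseq iter_mulr_1.
Qed.

End ExponentSums.

(** * Non-vanishing of polynomials whose exponents are all below [p] *)

Section Nonvanishing.
Variables (L : fieldType) (p : nat) (hp : p \in [pchar L]).

Lemma natr_neq0_lt_pchar i : (0 < i < p)%N -> i%:R != 0 :> L.
Proof.
by move=> /andP [i_gt0 ip]; rewrite -(dvdn_pcharf hp) gtnNdvd.
Qed.

(** The nodes [0, ..., p-1] are distinct in [L], so their Vandermonde matrix is invertible. Column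
    [j] of the inverse extracts the coefficient of degree [j] from the values of a polynomial of
    degree below [p]. *)
Lemma interpolation_weights : exists w : nat -> 'I_p -> L,
  forall i j, (i < p)%N -> (j < p)%N ->
    \sum_(v < p) v%:R ^+ i * w j v = (i == j)%:R.
Proof.
pose V := Vandermonde p (\row_(v < p) (v : nat)%:R : 'rV[L]_p).
have Vu : V \in unitmx.
  rewrite unitmxE det_Vandermonde unitfE.
  apply/prodf_neq0 => i _; apply/prodf_neq0 => j ij.
  rewrite !mxE -natrB ?(ltnW ij) // natr_neq0_lt_pchar // subn_gt0 ij.
  exact: leq_ltn_trans (leq_subr _ _) (ltn_ord j).
exists (fun j v => if insub j is Some j' then invmx V v j' else 0) => i j ip jp.
have := congr1 (fun M : 'M_p => M (Ordinal ip) (Ordinal jp)) (mulmxV Vu).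
rewrite !mxE -val_eqE /= => <-; apply: eq_bigr => v _.
by rewrite insubT !mxE.
Qed.

Lemma meval_neq0_low_degree n (Theta : mpoly n L) :
  (forall k, k \in msupp Theta -> forall i, (k i < p)%N) ->
  Theta != 0 -> exists u, meval u Theta != 0.
Proof.
move=> low Theta0; apply/not_existsP => ev0.
have {}ev0 u : meval u Theta = 0 by apply/eqP/negP => /negP; exact: ev0.
have [w wE] := interpolation_weights.
have k0s := mlead_supp Theta0; set k0 := mlead Theta in k0s.
(* Interpolation in each variable separately: with these product weights, the values on the grid
   [{0, ..., p-1}^n] sum to the coefficient of [Theta] at [k0]. *)
have : \sum_(phi : {ffun 'I_n -> 'I_p})
    meval (fun i => (phi i : nat)%:R) Theta * \prod_i w (k0 i) (phi i) = 0.
  by apply: big1 => phi _; rewrite ev0 mul0r.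
under eq_bigr do rewrite mevalE mulr_suml.
rewrite exchange_big big_seq.
have sumE k : k \in msupp Theta ->
    \sum_(phi : {ffun 'I_n -> 'I_p}) mcoeff k Theta *
      (\prod_i (phi i : nat)%:R ^+ k i) * \prod_i w (k0 i) (phi i) =
    mcoeff k Theta * (k == k0)%:R.
  move=> ks; under eq_bigr do rewrite -mulrA -big_split.
  rewrite -mulr_sumr -(bigA_distr_bigA (fun i (v : 'I_p) => v%:R ^+ k i * w (k0 i) v)).
  congr (_ * _); under eq_bigr do rewrite wE ?low //.
  have [<-|kk0] := eqVneq k k0; first by rewrite big1 // => i _; rewrite eqxx.
  apply/eqP; apply: contraNT kk0 => /prodf_neq0 kk0; apply/eqP/mnmP => i.
  by have := kk0 i isT; case: (k i =P k0 i); rewrite ?eqxx.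
rewrite (eq_bigr _ sumE) -big_seq (bigD1_seq k0) //= eqxx mulr1.
rewrite big1 ?addr0 => [/eqP|k /negbTE ->]; last by rewrite mulr0.
by apply/negP; rewrite -mcoeff_msupp.
Qed.

End Nonvanishing.

(** * Multinomial coefficients and the coefficients of [f^N] *)

Section MultinomialPower.
Variables (L : fieldType) (n : nat).
Implicit Types (k : multinom n) (N : nat).

Definition sum_vars_exp N : mpoly n L := (\sum_(i < n) mpolyX L (mnm1 i)) ^+ N.

Lemma mdeg_sum_vars_exp N k : k \in msupp (sum_vars_exp N) -> mdeg k = N.
Proof.
suff /dhomogP : sum_vars_exp N \is ishomog1 (1 * N) mdeg by rewrite mul1n; apply.
apply: dhomogMn; apply: rpred_sum => i _.
by rewrite dhomogX /= mdeg1.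
Qed.

(** The multinomial formula with denominators cleared, as factorials may vanish in [L]. In the
    induction, [N + 1] is split as the sum of the [k i], one term for each variable factored out. *)
Lemma mcoeff_sum_vars_exp N k : mdeg k = N ->
  mcoeff k (sum_vars_exp N) * (\prod_i (k i)`!)%:R = N`!%:R.
Proof.
elim: N k => [|N IHN] k kN.
  have /eqP -> : k == mnm0 by rewrite -mdeg_eq0 kN.
  rewrite /sum_vars_exp expr0 mcoeff1 eqxx mul1r.
  by rewrite big1 // => i _; rewrite mnm0E.
rewrite /sum_vars_exp exprS -/(sum_vars_exp N) mulr_suml raddf_sum /= mulr_suml.
rewrite factS -kN mdegE natrM natr_sum mulr_suml; apply: eq_bigr => i _.
rewrite mulrC [X in mcoeff k X]mulrC mpoly_mulXE; case: ifPn => [/mnm_lepP ik | ik].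
  have ki : (0 < k i)%N by have := ik i; rewrite mnm1E eqxx.
  set l := mnm_sub k (mnm1 i).
  rewrite -(IHN l); last first.
    have := congr1 (@mdeg n) (submK (introT mnm_lepP ik)).
    by rewrite mdegD mdeg1 kN addn1 => - [].
  rewrite mulrCA mulrC -natrM; congr (_ * _%:R).
  rewrite (bigD1 i) //= [in RHS](bigD1 i) //= mulnA; congr (_ * _)%N.
    by rewrite mnmBE mnm1E eqxx subn1 -[in LHS](prednK ki) factS prednK.
  apply: eq_bigr => j ji.
  by rewrite mnmBE mnm1E eq_sym (negbTE ji) subn0.
suff -> : k i = 0%N by rewrite mulr0 mul0r.
apply/eqP; rewrite -leqn0 leqNgt; apply: contra ik => ki.
by apply/mnm_lepP => j; rewrite mnm1E; case: eqP => [<-|].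
Qed.

Variables (m : nat) (a : 'I_n -> multinom m).

(** The coefficient of [x^r] in [f^N] as a polynomial in the coefficients of [f]; for [N = mdeg k]
    and [r = E k] this is Theta. *)
Definition power_coeff N (r : multinom m) : mpoly n L :=
  \sum_(k <- msupp (sum_vars_exp N) | exponent_sum a k == r)
    mcoeff k (sum_vars_exp N) *: mpolyX L k.

Lemma meval_power_coeff N r (u : 'I_n -> L) :
  meval u (power_coeff N r) =
  mcoeff r ((\sum_i u i *: mpolyX L (a i)) ^+ N).
Proof.
(* Substituting [u_i x^(a_i)] for the variables of [sum_vars_exp N] gives [f^N]. *)
have -> : (\sum_i u i *: mpolyX L (a i)) ^+ N =
    comp_mpoly [tuple u i *: mpolyX L (a i) | i < n] (sum_vars_exp N).
  rewrite rmorphXn rmorph_sum; congr (_ ^+ _); apply: eq_bigr => i _.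
  by rewrite /= comp_mpolyXU -tnth_nth tnth_mktuple.
rewrite comp_mpolyE !raddf_sum /= big_mkcond; apply: eq_bigr => k _.
under [in RHS]eq_bigr do rewrite tnth_mktuple exprZn.
rewrite scaler_prod -mpolyX_exponent_sum !mcoeffZ mcoeffX.
case: ifP => _; rewrite ?mulr0 //.
by rewrite mevalZ mevalX mulr1.
Qed.

Lemma mcoeff_power_coeff N r k :
  mcoeff k (power_coeff N r) =
  if exponent_sum a k == r then mcoeff k (sum_vars_exp N) else 0.
Proof.
rewrite raddf_sum /=; under eq_bigr do rewrite mcoeffZ mcoeffX.
have [ks|ks] := boolP (k \in msupp (sum_vars_exp N)).
  rewrite big_mkcond (bigD1_seq k) //= eqxx mulr1 big1 ?addr0 // => l lk.
  by rewrite (negbTE lk) mulr0 if_same.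
rewrite (memN_msupp_eq0 ks) if_same big_seq_cond big1 // => l /andP [ls _].
by case: eqP => [lk|]; rewrite ?mulr0 //; rewrite -lk ls in ks.
Qed.

Lemma power_coeff_neq0 (p N : nat) k : p \in [pchar L] ->
  (N < p)%N -> mdeg k = N -> power_coeff N (exponent_sum a k) != 0.
Proof.
move=> hp Np kN; apply/eqP => /(congr1 (mcoeff k)).
rewrite mcoeff_power_coeff eqxx mcoeff0 => G0.
(* A zero coefficient at [k] would make [N!] vanish in [L], but the prime [p > N] divides no factor
   of [N!]. *)
have := mcoeff_sum_vars_exp kN; rewrite G0 mul0r => /esym /eqP.
rewrite -(dvdn_pcharf hp); apply/negP.
have := Np; elim: N {k kN G0 Np} => [|N IHN] Np.
  by rewrite dvdn1 neq_ltn prime_gt1 ?orbT // (pcharf_prime hp).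
by rewrite factS Euclid_dvdM ?(pcharf_prime hp) // gtnNdvd // IHN // ltnW.
Qed.

End MultinomialPower.

(** * Both thresholds equal the coordinate sum of a maximal point *)

Section FptOfMaximalPoint.
Variables (R : realType) (p : nat) (L : fieldType) (hp : p \in [pchar L]).
Variables (m n : nat) (a : 'I_n -> multinom m) (eta : 'cV[R]_n).
Variable (k : multinom n).
Hypotheses (eta_max : maximal_point a eta)
  (kE : forall i, (p%:R - 1) * eta i 0 = (k i)%:R).

Let p_gt1 : (1 < p)%N := prime_gt1 (pcharf_prime hp).

Let p1E : p%:R - 1 = (p.-1)%:R :> R.
Proof. by rewrite -subn1 natrB // ltnW. Qed.

Lemma mdeg_maximal_point : (mdeg k)%:R = p.-1%:R * coord_sum eta.
Proof.
rewrite mdegE natr_sum mulr_sumr; apply: eq_bigr => i _.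
by rewrite -kE p1E.
Qed.

Lemma exponent_sum_maximal_point i : (exponent_sum a k i <= p.-1)%N.
Proof.
have [[_ /(_ i) le1] _] := eta_max; move: le1; rewrite mxE => le1.
rewrite -(ler_nat R) exponent_sumE natr_sum -[leRHS]mulr1.
apply: le_trans (ler_wpM2l (ler0n _ _) le1).
rewrite mulr_sumr le_eqVlt; apply/orP; left; apply/eqP.
by apply: eq_bigr => j _; rewrite mxE natrM -kE p1E mulrCA.
Qed.

Lemma fpt_ideal_gen_maximal (S : set (mpoly m L)) :
  (forall h, S h -> dominates_sum a 1 h) ->
  (forall e, exists2 g, has_small_monomial (p ^ e)%N g &
     ideal_pow (ideal_gen S) (mdeg k * \sum_(i < e) p ^ i) g) ->
  fpt R p (ideal_gen S) = coord_sum eta.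
Proof.
move=> S1 lb; apply: (fpt_eq p_gt1) => [|r q g q_gt0 Ig gs|e].
- by apply: sumr_ge0 => j _; case: eta_max => -[].
- exact: dominates_sum_le_maximal q_gt0 (dominates_sum_ideal_pow S1 Ig) gs.
have [g gs Ig] := lb e; exists (mdeg k * \sum_(i < e) p ^ i)%N, g; split=> //.
have pe_gt0 : (0 < p ^ e)%N by rewrite expn_gt0 ltnW.
(* Here [|k| = (p - 1) |eta|] meets [(p - 1)(1 + ... + p^(e-1)) = p^e - 1]. *)
rewrite -(natrB _ pe_gt0) subn1 predn_exp !natrM mdeg_maximal_point.
by rewrite mulrCA mulrA mulrC.
Qed.

Lemma dominates_sum_monomial j : dominates_sum a 1 (mpolyX L (a j)).
Proof.
move=> b; rewrite msuppX inE => /eqP ->; exists (mnm1 j); first exact: mdeg1.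
by rewrite exponent_sum1 lepm_refl.
Qed.

Lemma fpt_monomials_maximal_point : fpt_monomials L R p a = coord_sum eta.
Proof.
apply: fpt_ideal_gen_maximal => [_ [j _ <-]|e]; first exact: dominates_sum_monomial.
set c := (\sum_(i < e) _)%N.
(* The vector [c k] is [(p^e - 1) eta], so the entries of [E (c k)] are at most [p^e - 1]. *)
exists (mpolyX L (exponent_sum a (mnm_muln k c))).
  apply/hasP; exists (exponent_sum a (mnm_muln k c)); rewrite ?msuppX ?inE //.
  apply/forallP => i; rewrite exponent_sumE.
  under eq_bigr do rewrite mulmnE mulnA.
  rewrite -big_distrl -exponent_sumE /= -ltnS.
  have pe_gt0 : (0 < p ^ e)%N by rewrite expn_gt0 ltnW.
  by rewrite -[X in (_ < X.+1)%N](prednK pe_gt0) !ltnS predn_exp leq_mul2r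
    exponent_sum_maximal_point orbT.
rewrite -mdegMn; apply: ideal_pow_exponent_sum => j.
by apply: ideal_gen_mem; exists j.
Qed.

Lemma fpt_poly_maximal_point (u : 'I_n -> L) (f : mpoly m L) :
  f = \sum_(i < n) u i *: mpolyX L (a i) ->
  (forall b, b \in msupp f <-> exists i, b = a i) ->
  meval u (power_coeff L a (mdeg k) (exponent_sum a k)) != 0 ->
  fpt_poly R p f = coord_sum eta.
Proof.
move=> fE fsupp; rewrite meval_power_coeff -fE -mcoeff_msupp => fk.
apply: fpt_ideal_gen_maximal => [_ -> b /fsupp [j ->]|e].
  by apply: dominates_sum_monomial; rewrite msuppX inE.
exists (f ^+ (mdeg k * \sum_(i < e) p ^ i)).
  apply: (has_small_monomial_exp hp); apply/hasP.
  exists (exponent_sum a k) => //; apply/forallP => i.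
  by rewrite -[X in (_ < X)%N](prednK (ltnW p_gt1)) ltnS exponent_sum_maximal_point.
by apply: ideal_pow_exp; apply: ideal_gen_mem.
Qed.

(** All exponents of [x^(a_j)] are below [|a_j| + 1], so the polytope bound gives
    [1 <= |eta| (|a_j| + 1)], which excludes [|eta| = 0]. *)
Lemma mdeg_maximal_point_gt0 : (0 < n)%N -> (0 < mdeg k)%N.
Proof.
move=> n_gt0; pose j := Ordinal n_gt0.
have small : has_small_monomial (mdeg (a j)).+1 (mpolyX L (a j)).
  apply/hasP; exists (a j); rewrite ?msuppX ?inE //; apply/forallP => i.
  by rewrite ltnS mdegE (bigD1 i) //= leq_addr.
have := dominates_sum_le_maximal eta_max (ltn0Sn _) (@dominates_sum_monomial j) small.
rewrite lt0n; apply: contraTneq => k0.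
have : p.-1%:R * coord_sum eta == 0 by rewrite -mdeg_maximal_point k0.
rewrite mulf_eq0 pnatr_eq0 -[p.-1 == _]negbK -lt0n -subn1 subn_gt0 p_gt1 /=.
by move=> /eqP ->; rewrite mul0r -ltNge ltr01.
Qed.

End FptOfMaximalPoint.

Theorem proposition3p21 (R : realType) (p : nat) (L : fieldType)
    (hp : p \in [pchar L]) (hF : F_finite p L)
    (m n : nat) (n_gt0 : (0 < n)%N)
    (a : 'I_n -> multinom m) (a_inj : injective a) (a_neq0 : forall i, a i != mnm0)
    (hfpt : fpt_monomials L R p a <= 1)
    (heta : exists eta : 'cV[R]_n, maximal_point a eta /\
              forall i, (p%:R - 1) * eta i 0 \is a Num.nat) :
  exists Z : set ('I_n -> L),
    [/\ zariski_closed Z, Z !=set0, Z <> [set: 'I_n -> L] &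
      forall (u : 'I_n -> L) (f : mpoly m L),
        f = \sum_(i < n) u i *: mpolyX L (a i) ->
        (forall b : multinom m, b \in msupp f <-> exists i, b = a i) ->
        ~ Z u ->
        fpt_poly R p f = fpt_monomials L R p a].
Proof.
case: heta => eta [eta_max eta_nat].
have [k0 k0E] := choice (fun i => natrP (eta_nat i)).
pose k := Multinom (mktuple k0).
have kE i : (p%:R - 1) * eta i 0 = (k i)%:R by rewrite mnmE.
have fptM := fpt_monomials_maximal_point hp eta_max kE.
have p_gt0 : (0 < p)%N := prime_gt0 (pcharf_prime hp).
(* This is where the threshold of M being at most 1 enters: [|k| = (p - 1) |eta| <= p - 1]. *)
have kp : (mdeg k < p)%N.
  rewrite -[X in (_ < X)%N](prednK p_gt0) ltnS -(ler_nat R).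
  by rewrite (mdeg_maximal_point hp kE) ler_piMr // -fptM.
pose Theta := power_coeff L a (mdeg k) (exponent_sum a k).
have low l : l \in msupp Theta -> forall i, (l i < p)%N.
  rewrite mcoeff_msupp mcoeff_power_coeff; case: ifP => _; last by rewrite eqxx.
  rewrite -mcoeff_msupp => /mdeg_sum_vars_exp lk i; apply: leq_ltn_trans kp.
  by rewrite -lk mdegE (bigD1 i) //= leq_addr.
exists [set u | meval u Theta = 0]; split.
- exists [set Theta]; apply/seteqP; split=> [u u0 _ -> //|u]; exact.
(* At the origin the polynomial is 0, and its power of positive exponent [mdeg k] has only zero
   coefficients. *)
- exists (fun=> 0); rewrite /= meval_power_coeff.
  rewrite big1 => [|i _]; last exact: scale0r.
  by rewrite expr0n gtn_eqF ?mcoeff0 // (mdeg_maximal_point_gt0 hp eta_max kE).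
- have [u u0] := meval_neq0_low_degree hp low (power_coeff_neq0 a hp kp erefl).
  by move=> /seteqP [_ /(_ u I)] /eqP; apply/negP.
move=> u f fE fsupp /eqP Zu; rewrite fptM.
exact: (fpt_poly_maximal_point hp eta_max kE fE fsupp Zu).
Qed.
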